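(* Let $X=(\xi_1,\dots,\xi_n)$ be a random vector in $\mathbb{C}^n$ which is in isotropic position and is $K$-concentrated with constants $C_0,C_0'>0$. Then there are constants $C,C'>0$, depending only on $C_0,C_0'$, such that the following holds. Let $H\subset\mathbb{C}^n$ be a subspace of dimension $d$ with an orthonormal basis $\{u_1,\dots,u_d\}$. Then for any real numbers $c_1,\dots,c_d$ with $0\le c_j\le 1$ for all $j$, and any $t>0$, $$\mathbf{P}\left(\left|\sqrt{\sum_{j=1}^d c_j|u_j^*X|^2}-\sqrt{\sum_{j=1}^d c_j}\right|\ge t\right)\le C\exp\left(-C'\frac{t^2}{K^2}\right).$$
   Context: A random vector $X$ in $\mathbb{C}^n$ is in isotropic position if $\mathbf{E}\,XX^*=\mathrm{Id}$ (the $n\times n$ identity matrix). Let $K>0$ (possibly depending on $n$). A random vector $X$ in $\mathbb{C}^n$ is $K$-concentrated, with constants $C_0,C_0'>0$ (not depending on $n$), if for every convex function $F:\mathbb{C}^n\to\mathbb{R}$ that is $1$-Lipschitz with respect to the Euclidean norm and every $t>0$, $$\mathbf{P}(|F(X)-M(F(X))|\ge t)\le C_0\exp\left(-C_0'\frac{t^2}{K^2}\right),$$ where $M(Y)$ denotes a median of the real random variable $Y$ (chosen arbitrarily if there are several). *)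

(* Defs.v *)
From HB Require Import structures.
From mathcomp Require Import all_boot all_order all_algebra.
From mathcomp Require Import complex.
From mathcomp Require Import all_classical all_reals all_analysis.

Set Implicit Arguments.
Unset Strict Implicit.
Unset Printing Implicit Defensive.

Import Order.TTheory GRing.Theory Num.Theory.
Import numFieldNormedType.Exports.

Local Open Scope classical_set_scope.
Local Open Scope ring_scope.
Local Open Scope complex_scope.
Local Open Scope sesquilinear_scope.

(* The modulus as an element of R; `|z| itself lives in R[i]. *)
Definition cmod (R : realType) (z : R[i]) : R := ComplexField.Normc.normc z.

(* The norm that MathComp-Analysis puts on matrices is the sup norm, hence
   this definition. *)
Definition l2norm (R : realType) (n : nat) (x : 'cV[R[i]]_n) : R :=
  Num.sqrt (\sum_(i < n) cmod (x i 0) ^+ 2).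

Definition lipschitz1 (R : realType) (n : nat) (F : 'cV[R[i]]_n -> R) : Prop :=
  forall x y, `|F x - F y| <= l2norm (x - y).

(* C^n is regarded as a real vector space here. *)
Definition convex_fun (R : realType) (n : nat) (F : 'cV[R[i]]_n -> R) : Prop :=
  forall (x y : 'cV[R[i]]_n) (s : R), 0 <= s <= 1 ->
    F (s%:C *: x + (1 - s)%:C *: y) <= s * F x + (1 - s) * F y.

Section RandomVectors.
Context (disp : measure_display) (T : measurableType disp) (R : realType)
        (P : probability T R).

Definition random_vector (n : nat) (X : T -> 'cV[R[i]]_n) : Prop :=
  forall i, measurable_fun setT (fun w => complex.Re (X w i 0)) /\
            measurable_fun setT (fun w => complex.Im (X w i 0)).

Definition cintegrable (Z : T -> R[i]) : Prop :=
  P.-integrable setT (fun w => (complex.Re (Z w))%:E) /\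
  P.-integrable setT (fun w => (complex.Im (Z w))%:E).

Definition cexpectation (Z : T -> R[i]) : R[i] :=
  fine 'E_P[fun w => complex.Re (Z w)] +i* fine 'E_P[fun w => complex.Im (Z w)].

Definition mxexpectation (m n : nat) (A : T -> 'M[R[i]]_(m, n)) :
    'M[R[i]]_(m, n) :=
  \matrix_(i, j) cexpectation (fun w => A w i j).

(* Integrability is what it means for E XX^* to exist; it has to be required
   since [fine] maps infinite values to 0. *)
Definition isotropic (n : nat) (X : T -> 'cV[R[i]]_n) : Prop :=
  (forall i j, cintegrable (fun w => (X w *m (X w) ^t*) i j)) /\
  mxexpectation (fun w => X w *m (X w) ^t*) = 1%:M.

Definition is_median (Y : T -> R) (m : R) : Prop :=
  ((2^-1)%:E <= P [set w | (Y w <= m)%R])%E /\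
  ((2^-1)%:E <= P [set w | (m <= Y w)%R])%E.

(* The median of F(X) is chosen arbitrarily: the tail bound is required for
   one choice of median, the same for all t. *)
Definition concentrated (C0 C0' K : R) (n : nat) (X : T -> 'cV[R[i]]_n) :
    Prop :=
  forall F : 'cV[R[i]]_n -> R, convex_fun F -> lipschitz1 F ->
  exists2 m : R, is_median (F \o X) m &
    forall t : R, 0 < t ->
      (P [set w | (t <= `|F (X w) - m|)%R]
        <= (C0 * expR (- C0' * (t ^+ 2 / K ^+ 2)))%:E)%E.

End RandomVectors.

Definition orthonormal_basis (R : realType) (n d : nat)
    (H : {vspace 'cV[R[i]]_n}) (u : d.-tuple 'cV[R[i]]_n) : Prop :=
  basis_of H u /\
  forall j k : 'I_d, (tnth u j) ^t* *m tnth u k = ((j == k)%:R)%:M.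

(* Main.v *)
Require Import Defs.
From HB Require Import structures.
From mathcomp Require Import all_boot all_order all_algebra.
From mathcomp Require Import complex.
From mathcomp Require Import all_classical all_reals all_analysis.

Set Implicit Arguments.
Unset Strict Implicit.
Unset Printing Implicit Defensive.

Import Order.TTheory GRing.Theory Num.Theory.
Import numFieldNormedType.Exports.

Local Open Scope classical_set_scope.
Local Open Scope ring_scope.
Local Open Scope complex_scope.
Local Open Scope sesquilinear_scope.

From mathcomp Require Import measurable_realfun.
From mathcomp Require Import ring lra.

(** Write [F x := sqrt (\sum_j c_j |u_j^* x|^2)]. Collecting the basis in a
    matrix [U] with columns [u_j] and putting [D := diag (sqrt c_j)], this is
    [F x = |A x|] for [A := D U^*], the Euclidean norm of a linear image. It is
    therefore convex, and it is 1-Lipschitz as soon as [A] does not increase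
    norms, which is Bessel's inequality together with [c_j <= 1]
    ([nonexpansive_weighted_coord]). So concentration applies to [F X] and
    gives a subgaussian tail around some median [m].

    What remains is to replace [m] by [s := sqrt (\sum_j c_j)]. Isotropy makes
    [s] the root mean square of [F X]: [E |A X|^2 = tr (A^* A) = \sum_j c_j]
    ([isotropic_sqr_l2norm], [trace_weighted_coord]). On the other hand the tail
    around [m] integrates to [E (F X - m)^2 <= (C0 / C0') K^2]
    ([integral_sqr_le_of_tail]). The triangle inequality in L^2 between [F X]
    and the constant [m >= 0] then yields [(s - m)^2 <= (C0 / C0') K^2]
    ([sqr_rms_sub_le]): the two centres are at distance [O(K)].

    A shift of the centre by [O(K)] costs only constants ([tail_recenter]).
    If [t >= 2 |s - m|], a deviation by [t] from [s] forces one by [t / 2] from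
    [m]; if [t < 2 |s - m|], then [C0' t^2 / (4 K^2) <= C0], and the claimed
    bound is at least 1 for [C' = C0' / 4] and [C = C0 + exp C0]. *)

(** * The Euclidean norm on C^n *)

Lemma sqr_cmod (R : realType) (z : R[i]) :
  cmod z ^+ 2 = complex.Re z ^+ 2 + complex.Im z ^+ 2.
Proof.
by case: z => a b; rewrite /cmod /= sqr_sqrtr// addr_ge0 ?sqr_ge0.
Qed.

Lemma sqr_cmodC (R : realType) (z : R[i]) : (cmod z ^+ 2)%:C = z * z^*.
Proof. by rewrite sqr_cmod add_Re2_Im2 sqr_normc. Qed.

Lemma cmod_ge0 (R : realType) (z : R[i]) : 0 <= cmod z.
Proof. by case: z => a b; rewrite /cmod sqrtr_ge0. Qed.

Section L2norm.
Context (R : realType).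
Implicit Types m n : nat.

Lemma l2norm_ge0 n (x : 'cV[R[i]]_n) : 0 <= l2norm x.
Proof. exact: sqrtr_ge0. Qed.

Lemma sqr_l2norm n (x : 'cV[R[i]]_n) :
  l2norm x ^+ 2 = \sum_(i < n) cmod (x i 0) ^+ 2.
Proof. by rewrite sqr_sqrtr// sumr_ge0// => i _; rewrite sqr_ge0. Qed.

Lemma sqr_l2norm_dot n (x : 'cV[R[i]]_n) :
  (l2norm x ^+ 2)%:C%:M = x ^t* *m x.
Proof.
apply/matrixP => i j; rewrite !ord1 !mxE eqxx mulr1n sqr_l2norm rmorph_sum /=.
by apply: eq_bigr => k _; rewrite sqr_cmodC !mxE mulrC.
Qed.

Lemma l2norm_eq0 n (x : 'cV[R[i]]_n) : l2norm x = 0 -> x = 0.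
Proof.
move=> x0; have /psumr_eq0P x0i : \sum_(i < n) cmod (x i 0) ^+ 2 = 0.
  by rewrite -sqr_l2norm x0 expr0n.
apply/colP => i; rewrite mxE; apply: ComplexField.Normc.eq0_normc.
by apply/eqP; rewrite -[_ == 0](@sqrf_eq0 R) x0i// => j _; exact: sqr_ge0.
Qed.

Lemma l2normZ n (s : R) (x : 'cV[R[i]]_n) : 0 <= s ->
  l2norm (s%:C *: x) = s * l2norm x.
Proof.
move=> s0; apply: (pexpIrn (n := 2)); rewrite ?nnegrE ?mulr_ge0 ?l2norm_ge0//.
rewrite exprMn !sqr_l2norm mulr_sumr; apply: eq_bigr => i _.
rewrite mxE /cmod ComplexField.Normc.normcM exprMn; congr (_ * _).
by rewrite -/(cmod _) sqr_cmod /= expr0n addr0.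
Qed.

(** Minkowski's inequality by weighted AM-GM: with [p = |x|] and [q = |y|], each
    coordinate satisfies [p q (a + b)^2 <= (p + q) (q a^2 + p b^2)], the
    difference being [(q a - p b)^2]; summing over the coordinates gives
    [p q |x + y|^2 <= p q (p + q)^2]. *)
Lemma l2norm_triangle n (x y : 'cV[R[i]]_n) :
  l2norm (x + y) <= l2norm x + l2norm y.
Proof.
have [/l2norm_eq0->|x0] := eqVneq (l2norm x) 0.
  by rewrite add0r lerDr l2norm_ge0.
have [/l2norm_eq0->|y0] := eqVneq (l2norm y) 0.
  by rewrite addr0 lerDl l2norm_ge0.
have {x0}p0 : 0 < l2norm x by rewrite lt_def x0 l2norm_ge0.
have {y0}q0 : 0 < l2norm y by rewrite lt_def y0 l2norm_ge0.
rewrite -ler_sqr ?nnegrE ?addr_ge0 ?l2norm_ge0//.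
set p := l2norm x in p0 *; set q := l2norm y in q0 *.
rewrite -(ler_pM2l (mulr_gt0 p0 q0)).
have -> : p * q * (p + q) ^+ 2 = (p + q) * (q * p ^+ 2 + p * q ^+ 2) by ring.
rewrite !sqr_l2norm !mulr_sumr -big_split/= mulr_sumr; apply: ler_sum => i _.
rewrite mxE; set a := cmod (x i 0); set b := cmod (y i 0).
have ab : cmod (x i 0 + y i 0) ^+ 2 <= (a + b) ^+ 2.
  by rewrite ler_sqr ?nnegrE ?addr_ge0 ?cmod_ge0// /cmod le_normcD.
apply: (le_trans (ler_wpM2l (ltW (mulr_gt0 p0 q0)) ab)).
rewrite -subr_ge0; have -> : (p + q) * (q * a ^+ 2 + p * b ^+ 2) -
  p * q * (a + b) ^+ 2 = (q * a - p * b) ^+ 2 by ring.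
exact: sqr_ge0.
Qed.

Definition nonexpansive m n (A : 'M[R[i]]_(m, n)) :=
  forall x : 'cV_n, l2norm (A *m x) <= l2norm x.

Lemma convex_l2norm_mul m n (A : 'M[R[i]]_(m, n)) :
  convex_fun (fun x => l2norm (A *m x)).
Proof.
move=> x y s /andP[s0 s1]; rewrite mulmxDr -!scalemxAr.
apply: (le_trans (l2norm_triangle _ _)).
by rewrite !l2normZ ?subr_ge0.
Qed.

Lemma lipschitz1_l2norm_mul m n (A : 'M[R[i]]_(m, n)) :
  nonexpansive A -> lipschitz1 (fun x => l2norm (A *m x)).
Proof.
move=> Anonexp x y; apply: le_trans (Anonexp (x - y)).
have opp (z : 'cV[R[i]]_m) : l2norm (- z) = l2norm z.
  rewrite /l2norm; congr Num.sqrt; apply: eq_bigr => i _.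
  by rewrite mxE /cmod normcN.
rewrite ler_distl; apply/andP; split.
  rewrite lerBlDl -(opp (A *m (x - y))) -mulmxN opprB.
  by apply: le_trans (l2norm_triangle _ _); rewrite -mulmxDr subrK.
by apply: le_trans (l2norm_triangle _ _); rewrite -mulmxDr addrC subrK.
Qed.

(** Bessel's inequality: [U U^* x] is the orthogonal projection of [x] on the
    range of [U], and by Pythagoras the norm of [U^* x] is that of the
    projection. *)
Lemma nonexpansive_adj_isometry m n (U : 'M[R[i]]_(n, m)) :
  U ^t* *m U = 1%:M -> nonexpansive (U ^t*).
Proof.
move=> U1 x; rewrite -ler_sqr ?nnegrE ?l2norm_ge0// -subr_ge0.
suff <- : l2norm (x - U *m (U ^t* *m x)) ^+ 2 =
  l2norm x ^+ 2 - l2norm (U ^t* *m x) ^+ 2 by exact: sqr_ge0.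
apply: complexI; rewrite rmorphB/=.
have scalarI (a b : R[i]) : a%:M = b%:M :> 'M[R[i]]_1 -> a = b.
  by move=> /matrixP/(_ 0 0); rewrite !mxE eqxx.
apply: scalarI; rewrite raddfB/= !sqr_l2norm_dot.
rewrite [(_ - _)^T]linearB /= map_mxB !trmx_mul !map_mxM /= trmxCK.
rewrite mulmxBl !mulmxBr !mulmxA.
rewrite -(mulmxA (x ^t* *m U) (U ^t*) U) U1 mulmx1.
by rewrite [X in _ - _ - X = _]subrr subr0.
Qed.

End L2norm.

(** * Second moments of isotropic vectors *)

Lemma ReM (R : realType) (a b : R[i]) :
  complex.Re (a * b) =
  complex.Re a * complex.Re b - complex.Im a * complex.Im b.
Proof. by case: a b => [? ?] []. Qed.

(** The trace exhibits [|A x|^2] as a linear function of the matrix [x x^*], whose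
    expectation is what isotropy prescribes. *)
Lemma sqr_l2norm_mul (R : realType) m n (A : 'M[R[i]]_(m, n)) (x : 'cV_n) :
  (l2norm (A *m x) ^+ 2)%:C = \tr ((A ^t* *m A) *m (x *m x ^t*)).
Proof.
rewrite -[LHS]mulr1n -mxtrace_scalar sqr_l2norm_dot trmx_mul map_mxM /=.
by rewrite -mulmxA mxtrace_mulC !mulmxA.
Qed.

Section isotropic_second_moment.
Context (disp : measure_display) (T : measurableType disp) (R : realType)
        (P : probability T R).

(** Expectation commutes with the linear functional [Re tr (B _)]. The entries are
    complex while integrals are real, so the functional is expanded into the
    real and imaginary parts of the entries of [B] and of [X X^*]. *)
Lemma isotropic_trace n (X : T -> 'cV[R[i]]_n) (B : 'M[R[i]]_n) :
  isotropic P X ->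
  P.-integrable setT
    (fun w => (complex.Re (\tr (B *m (X w *m (X w) ^t*))))%:E) /\
  (\int[P]_w (complex.Re (\tr (B *m (X w *m (X w) ^t*))))%:E =
   (complex.Re (\tr B))%:E)%E.
Proof.
move=> [intX EX].
pose Y w := X w *m (X w) ^t*.
have YE i j : (\int[P]_w (complex.Re (Y w i j))%:E = (i == j)%:R%:E /\
               \int[P]_w (complex.Im (Y w i j))%:E = 0)%E.
  move/matrixP/(_ i j): EX; rewrite !mxE /cexpectation unlock => /eqP.
  rewrite eq_complex /= => /andP[/eqP Re_ij /eqP Im_ij].
  have [intRe intIm] := intX i j.
  rewrite -[LHS]fineK ?integrable_fin_num//.
  rewrite -[X in _ /\ X = _]fineK ?integrable_fin_num//.
  split; congr EFin; [rewrite Re_ij | rewrite Im_ij]; by case: (i == j).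
pose h (p : 'I_n * 'I_n) w : \bar R :=
  ((complex.Re (B p.1 p.2))%:E * (complex.Re (Y w p.2 p.1))%:E -
   (complex.Im (B p.1 p.2))%:E * (complex.Im (Y w p.2 p.1))%:E)%E.
have trE w : (complex.Re (\tr (B *m Y w)))%:E = (\sum_p h p w)%E.
  rewrite /mxtrace !raddf_sum /= -(pair_bigA _ (fun i j => h (i, j) w)).
  apply: eq_bigr => i _; rewrite mxE !raddf_sum /=.
  by apply: eq_bigr => j _; rewrite ReM.
have inth1 p : P.-integrable setT
    (fun w => ((complex.Re (B p.1 p.2))%:E * (complex.Re (Y w p.2 p.1))%:E)%E).
  by apply: integrableZl => //; have [] := intX p.2 p.1.
have inth2 p : P.-integrable setT
    (fun w => ((complex.Im (B p.1 p.2))%:E * (complex.Im (Y w p.2 p.1))%:E)%E).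
  by apply: integrableZl => //; have [] := intX p.2 p.1.
have inth p : P.-integrable setT (h p) by exact: integrableB.
have Eh p : (\int[P]_w h p w = (complex.Re (B p.1 p.2) * (p.2 == p.1)%:R)%:E)%E.
  have [? ?] := intX p.2 p.1; rewrite integralB// !integralZl//.
  by have [-> ->] := YE p.2 p.1; rewrite mule0 sube0.
split.
  by under eq_fun do rewrite trE; exact: integrable_sum.
under eq_integral do rewrite trE.
rewrite integral_sum// (eq_bigr _ (fun p _ => Eh p)) sumEFin /=; congr EFin.
rewrite -(pair_bigA _ (fun i j => complex.Re (B i j) * (j == i)%:R)) /=.
rewrite /mxtrace raddf_sum; apply: eq_bigr => i _ /=.
rewrite (bigD1 i)//= eqxx mulr1 big1 ?addr0// => j /negPf ->.
by rewrite mulr0.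
Qed.

Lemma isotropic_sqr_l2norm m n (X : T -> 'cV[R[i]]_n) (A : 'M[R[i]]_(m, n)) :
  isotropic P X ->
  P.-integrable setT (fun w => (l2norm (A *m X w) ^+ 2)%:E) /\
  (\int[P]_w (l2norm (A *m X w) ^+ 2)%:E =
   (complex.Re (\tr (A ^t* *m A)))%:E)%E.
Proof.
move=> /isotropic_trace => /(_ (A ^t* *m A)) [int_tr E_tr].
have fE w : l2norm (A *m X w) ^+ 2 =
    complex.Re (\tr (A ^t* *m A *m (X w *m (X w) ^t*))).
  by rewrite -sqr_l2norm_mul.
split; first by under eq_fun do rewrite fE.
by under eq_integral do rewrite fE.
Qed.

End isotropic_second_moment.

(** * Tail bounds and recentring *)

Lemma measurable_norm_ge d (T : measurableType d) (R : realType) (Y : T -> R)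
    (t : R) :
  measurable_fun setT Y ->
  measurable [set w | t <= `|Y w|].
Proof.
move=> mY; have mnY : measurable_fun setT (fun w => `|Y w|).
  exact: (measurableT_comp (@normr_measurable R setT)).
rewrite -[X in measurable X]setTI.
rewrite (_ : [set w | _] = (fun w => `|Y w|) @^-1` `[t, +oo[).
  by apply: (mnY measurableT); exact: measurable_itv.
by apply/seteqP; split => w; rewrite /= in_itv/= andbT.
Qed.

Section deviation.
Context (disp : measure_display) (T : measurableType disp) (R : realType)
        (P : probability T R).

(** A median of a nonnegative variable cannot be negative, since a negative
    number bounds [Y] on a set of probability 0 instead of 1/2. *)
Lemma median_ge0 (Y : T -> R) (m : R) :
  (forall w, 0 <= Y w) -> is_median P Y m -> 0 <= m.
Proof.
move=> Y0 [half _]; rewrite leNgt; apply/negP => m0; move: half.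
rewrite (_ : [set w | Y w <= m] = set0) ?measure0 ?lee_fin ?invr_le0 ?lern0//.
apply/seteqP; split => w //= Ywm.
by have := le_lt_trans (le_trans (Y0 w) Ywm) m0; rewrite ltxx.
Qed.

(** Layer cake: [E Y^2] is the integral of [P (Y^2 > x)] over [x >= 0], and the
    hypothesis at [t = sqrt x] bounds the integrand by [a exp (- b x)], that is,
    by [a / b] times the density of the exponential distribution of rate [b],
    whose integral is 1. *)
Lemma integral_sqr_le_of_tail (Y : T -> R) (a b : R) :
  0 <= a -> 0 < b -> measurable_fun setT Y ->
  (forall t, 0 < t ->
    (P [set w | (t <= `|Y w|)%R] <= (a * expR (- b * t ^+ 2))%:E)%E) ->
  (\int[P]_w (Y w ^+ 2)%:E <= (a / b)%:E)%E.
Proof.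
move=> a0 b0 mY tail.
have mY2 : measurable_fun setT (fun w => Y w ^+ 2) by exact: measurable_funX.
pose Z : {RV P >-> R} := mfun_Sub (mem_set mY2).
have -> : (\int[P]_w (Y w ^+ 2)%:E = 'E_P[Z])%E by rewrite expectation_def.
rewrite ge0_expectation_ccdf; last by move=> w; exact: sqr_ge0.
(* The tail bound says nothing at t = 0, so the endpoint x = 0 is dropped. *)
rewrite -(@integral_itv_obnd_cbnd _ _ +oo%O); last first.
  by apply: measurable_funTS; exact: ccdf_measurable.
have pdf_ge0 x : 0 <= a / b * exponential_pdf b x.
  by rewrite mulr_ge0 ?divr_ge0 ?exponential_pdf_ge0// ltW.
apply: (@le_trans _ _
    (\int[lebesgue_measure]_(x in `]0%R, +oo[)
      (a / b * exponential_pdf b x)%:E)%E).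
  apply: ge0_le_integral => //.
  - by apply: measurable_funTS; exact: ccdf_measurable.
  - apply/measurable_EFinP/measurable_funTS/measurable_funM => //.
    exact: measurable_exponential_pdf.
  - move=> x; rewrite /= in_itv/= andbT => x0.
    rewrite (exponential_pdfE _ (ltW x0)) mulrA divfK ?gt_eqF//.
    have := tail (Num.sqrt x); rewrite sqrtr_gt0 => /(_ x0).
    rewrite (sqr_sqrtr (ltW x0)); apply: le_trans.
    rewrite [ccdf Z x](_ : _ = P [set w | (x < Y w ^+ 2)%R]); last first.
      by congr (P _); apply/seteqP; split => w; rewrite /= in_itv/= andbT.
    apply: le_measure; rewrite ?inE.
    - rewrite -[X in measurable X]setTI.
      rewrite (_ : [set w | _] = (fun w => Y w ^+ 2) @^-1` `]x, +oo[).
        by apply: (mY2 measurableT); exact: measurable_itv.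
      by apply/seteqP; split => w; rewrite /= in_itv/= andbT.
    - exact: measurable_norm_ge.
    - move=> w /= /ltW xY.
      by rewrite -sqrtr_sqr ler_wsqrtr.
apply: (@le_trans _ _
    (\int[lebesgue_measure]_x (a / b * exponential_pdf b x)%:E)%E).
  apply: ge0_subset_integral => //.
  - apply/measurable_EFinP/measurable_funM => //.
    exact: measurable_exponential_pdf.
  - by move=> x _; rewrite lee_fin pdf_ge0.
under eq_integral do rewrite EFinM.
rewrite ge0_integralZl_EFin//; last 3 first.
- by move=> x _; rewrite lee_fin exponential_pdf_ge0// ltW.
- by apply/measurable_EFinP; exact: measurable_exponential_pdf.
- by rewrite divr_ge0// ltW.
by rewrite integral_exponential_pdf// mule1.
Qed.

(** The triangle inequality in L^2 between [Y] and the constant [m], where [s] is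
    the root mean square of [Y]. It follows by integrating
    [(Y - m)^2 >= (1 - m / s) Y^2 + m^2 - m s], the difference of whose two sides
    is [(m / s) (Y - s)^2]; the right-hand side, being affine in [Y^2], has
    integral [(s - m)^2]. *)
Lemma sqr_rms_sub_le (Y : T -> R) (s m v : R) :
  0 < s -> 0 <= m -> measurable_fun setT Y ->
  P.-integrable setT (fun w => (Y w ^+ 2)%:E) ->
  (\int[P]_w (Y w ^+ 2)%:E = (s ^+ 2)%:E)%E ->
  (\int[P]_w ((Y w - m) ^+ 2)%:E <= v%:E)%E ->
  (s - m) ^+ 2 <= v.
Proof.
move=> s0 m0 mY intY EY Ev.
have mYm : measurable_fun setT (fun w => ((Y w - m) ^+ 2)%:E).
  by apply/measurable_EFinP/measurable_funX/measurable_funB.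
have intYm : P.-integrable setT (fun w => ((Y w - m) ^+ 2)%:E).
  apply/integrableP; split => //.
  under eq_integral do rewrite gee0_abs ?lee_fin ?sqr_ge0//.
  exact: le_lt_trans Ev (ltry v).
have int_aff : P.-integrable setT
    (fun w => ((1 - m / s)%:E * (Y w ^+ 2)%:E + (m ^+ 2 - m * s)%:E)%E).
  apply: integrableD => //; first exact: integrableZl.
  exact: finite_measure_integrable_cst.
have : (\int[P]_w ((1 - m / s)%:E * (Y w ^+ 2)%:E + (m ^+ 2 - m * s)%:E)
    <= v%:E)%E.
  apply: le_trans Ev; apply: le_integral => // w _.
  rewrite -EFinM -EFinD lee_fin -subr_ge0.
  have -> : (Y w - m) ^+ 2 - ((1 - m / s) * Y w ^+ 2 + (m ^+ 2 - m * s)) =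
    m / s * (Y w - s) ^+ 2 by field; exact: lt0r_neq0.
  by rewrite mulr_ge0 ?sqr_ge0// divr_ge0// ltW.
rewrite integralD//; [|exact: integrableZl|exact: finite_measure_integrable_cst].
have PT : P setT = 1%E by exact: probability_setT.
rewrite integralZl// EY integral_cst//= PT.
rewrite mule1 -EFinM -EFinD lee_fin; apply: le_trans.
rewrite le_eqVlt; apply/orP; left; apply/eqP; field; exact: lt0r_neq0.
Qed.

(** When [t] is at least twice [|s - m|] the tail around [m] is used at [t / 2],
    which turns [C0'] into [C0' / 4]. For smaller [t] the exponent
    [(C0' / 4) t^2 / K^2] is at most [C0], so that the summand [exp C0] alone
    makes the bound at least 1. *)
Lemma tail_recenter (Y : T -> R) (C0 C0' K s m : R) :
  0 < C0 -> 0 < C0' -> 0 < K -> measurable_fun setT Y ->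
  (s - m) ^+ 2 <= C0 / C0' * K ^+ 2 ->
  (forall t, 0 < t -> (P [set w | (t <= `|Y w - m|)%R]
    <= (C0 * expR (- C0' * (t ^+ 2 / K ^+ 2)))%:E)%E) ->
  forall t, 0 < t -> (P [set w | (t <= `|Y w - s|)%R]
    <= ((C0 + expR C0) * expR (- (C0' / 4) * (t ^+ 2 / K ^+ 2)))%:E)%E.
Proof.
move=> C0_gt0 C0'_gt0 K_gt0 mY sm tail t t_gt0.
have mtail r c : measurable [set w | r <= `|Y w - c|].
  apply: measurable_norm_ge; exact: measurable_funB.
have [near|far] := leP `|s - m| (t / 2).
  apply: (@le_trans _ _ (P [set w | (t / 2 <= `|Y w - m|)%R])).
    apply: le_measure; rewrite ?inE; [exact: mtail|exact: mtail|].
    move=> w /= tY; have := ler_distD m (Y w) s; rewrite (distrC m s); lra.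
  apply: le_trans (tail _ (divr_gt0 t_gt0 _)) _ => //.
  rewrite lee_fin; have -> : - C0' * ((t / 2) ^+ 2 / K ^+ 2) =
    - (C0' / 4) * (t ^+ 2 / K ^+ 2) by field; exact: lt0r_neq0.
  by rewrite ler_wpM2r ?expR_ge0// lerDl expR_ge0.
apply: le_trans (probability_le1 P (mtail t s)) _; rewrite lee_fin.
have t2 : C0' / 4 * (t ^+ 2 / K ^+ 2) <= C0.
  have t2 : (t / 2) ^+ 2 <= C0 / C0' * K ^+ 2.
    apply: le_trans sm; rewrite -(real_normK (num_real (s - m))).
    by rewrite ler_sqr ?nnegrE ?normr_ge0// ?divr_ge0// ltW.
  have -> : C0' / 4 * (t ^+ 2 / K ^+ 2) = (t / 2) ^+ 2 * (C0' / K ^+ 2).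
    by field; exact: lt0r_neq0.
  have C0E : C0 = C0 / C0' * K ^+ 2 * (C0' / K ^+ 2).
    by field; rewrite !lt0r_neq0.
  rewrite [leRHS]C0E; apply: ler_wpM2r => //.
  by rewrite divr_ge0 ?exprn_ge0// ltW.
apply: (@le_trans _ _ (expR C0 * expR (- (C0' / 4) * (t ^+ 2 / K ^+ 2)))).
  by rewrite -expRD mulNr -[leLHS]expR0 ler_expR subr_ge0.
by rewrite ler_wpM2r ?expR_ge0// lerDr ltW.
Qed.

End deviation.

(** * Weighted orthonormal coordinates *)

Section weighted_coordinates.
Context (R : realType) (n d : nat).
Implicit Types (u : d.-tuple 'cV[R[i]]_n) (c : 'I_d -> R).

Definition frame_mx u : 'M[R[i]]_(n, d) := \matrix_(i, j) tnth u j i 0.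

Definition sqrt_weight_mx c : 'M[R[i]]_d :=
  diag_mx (\row_j (Num.sqrt (c j))%:C).

Definition weighted_coord_mx u c : 'M[R[i]]_(d, n) :=
  sqrt_weight_mx c *m (frame_mx u) ^t*.

Lemma frame_mx_isometry u :
  (forall j k, (tnth u j) ^t* *m tnth u k = ((j == k)%:R)%:M) ->
  (frame_mx u) ^t* *m frame_mx u = 1%:M.
Proof.
move=> orthu; apply/matrixP => j k; have /matrixP/(_ 0 0) := orthu j k.
rewrite !mxE eqxx mulr1n => <-; apply: eq_bigr => i _.
by rewrite !mxE.
Qed.

Lemma frame_mx_coord u (x : 'cV_n) j :
  ((frame_mx u) ^t* *m x) j 0 = ((tnth u j) ^t* *m x) 0 0.
Proof. by rewrite !mxE; apply: eq_bigr => i _; rewrite !mxE. Qed.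

Lemma sqr_l2norm_sqrt_weight c (y : 'cV[R[i]]_d) : (forall j, 0 <= c j) ->
  l2norm (sqrt_weight_mx c *m y) ^+ 2 = \sum_(j < d) c j * cmod (y j 0) ^+ 2.
Proof.
move=> c0; rewrite sqr_l2norm; apply: eq_bigr => j _.
rewrite mul_diag_mx !mxE /cmod ComplexField.Normc.normcM exprMn.
by congr (_ * _); rewrite -/(cmod _) sqr_cmod /= expr0n addr0 sqr_sqrtr.
Qed.

Lemma nonexpansive_weighted_coord u c :
  (forall j k, (tnth u j) ^t* *m tnth u k = ((j == k)%:R)%:M) ->
  (forall j, 0 <= c j <= 1) -> nonexpansive (weighted_coord_mx u c).
Proof.
move=> /frame_mx_isometry/nonexpansive_adj_isometry Unonexp c01 x.
apply: le_trans (Unonexp x); rewrite -mulmxA.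
rewrite -ler_sqr ?nnegrE ?l2norm_ge0// sqr_l2norm_sqrt_weight.
  rewrite sqr_l2norm; apply: ler_sum => j _.
  by rewrite ler_piMl ?sqr_ge0//; have /andP[] := c01 j.
by move=> j; have /andP[] := c01 j.
Qed.

Lemma trace_weighted_coord u c :
  (forall j k, (tnth u j) ^t* *m tnth u k = ((j == k)%:R)%:M) ->
  (forall j, 0 <= c j) ->
  complex.Re (\tr ((weighted_coord_mx u c) ^t* *m weighted_coord_mx u c)) =
  \sum_(j < d) c j.
Proof.
move=> /frame_mx_isometry U1 c0; rewrite mxtrace_mulC trmx_mul map_mxM /=.
rewrite trmxCK -(mulmxA (sqrt_weight_mx c)) (mulmxA _ (frame_mx u)) U1 mul1mx.
rewrite /sqrt_weight_mx tr_diag_mx map_diag_mx mulmx_diag mxtrace_diag.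
rewrite raddf_sum; apply: eq_bigr => j _; rewrite !mxE /=.
by rewrite oppr0 !mulr0 subr0 -expr2 sqr_sqrtr.
Qed.

End weighted_coordinates.

Theorem lemma1p2 (R : realType) (C0 C0' : R) (hC0 : 0 < C0) (hC0' : 0 < C0') :
  exists C C' : R, [/\ 0 < C, 0 < C' &
  forall (disp : measure_display) (T : measurableType disp)
    (P : probability T R) (n : nat) (K : R) (X : T -> 'cV[R[i]]_n),
  0 < K -> random_vector X -> isotropic P X -> concentrated P C0 C0' K X ->
  forall (d : nat) (H : {vspace 'cV[R[i]]_n}) (u : d.-tuple 'cV[R[i]]_n),
  \dim H = d -> orthonormal_basis H u ->
  forall c : 'I_d -> R, (forall j, 0 <= c j <= 1) ->
  forall t : R, 0 < t ->
  (P [set w | (t <= `| Num.sqrt (\sum_(j < d)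
                          c j * cmod (((tnth u j) ^t* *m X w) 0 0) ^+ 2)
                       - Num.sqrt (\sum_(j < d) c j) |)%R]
    <= (C * expR (- C' * (t ^+ 2 / K ^+ 2)))%:E)%E].
Proof.
exists (C0 + expR C0), (C0' / 4).
split; [by rewrite addr_gt0 ?expR_gt0|by rewrite divr_gt0|].
move=> disp T P n K X K_gt0 _ isoX concX d H u _ [_ orthu] c c01 t t_gt0.
have c0 j : 0 <= c j by have /andP[] := c01 j.
set S := \sum_(j < d) c j; have S_ge0 : 0 <= S by exact: sumr_ge0.
pose A := weighted_coord_mx u c.
have FE x : Num.sqrt (\sum_(j < d)
    c j * cmod (((tnth u j) ^t* *m x) 0 0) ^+ 2) = l2norm (A *m x).
  rewrite -[RHS](@ger0_norm R) ?l2norm_ge0// -sqrtr_sqr.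
  rewrite -mulmxA sqr_l2norm_sqrt_weight//.
  by congr Num.sqrt; apply: eq_bigr => j _; rewrite frame_mx_coord.
(* If all weights vanish, F is identically 0 and there is no deviation; this
   case is apart because the L^2 comparison divides by the root mean square. *)
have [S0|S_neq0] := eqVneq S 0.
  have c_eq0 j : c j = 0 by exact: (psumr_eq0P _ S0).
  rewrite (_ : [set w | _] = set0).
    by rewrite measure0 lee_fin mulr_ge0 ?addr_ge0 ?expR_ge0// ltW.
  apply/seteqP; split => w //=.
  rewrite S0 big1 => [|j _]; last by rewrite c_eq0 mul0r.
  by rewrite subrr normr0 leNgt t_gt0.
under eq_set do rewrite FE.
have s_gt0 : 0 < Num.sqrt S by rewrite sqrtr_gt0 lt_def S_neq0.
have [intF EF] := isotropic_sqr_l2norm A isoX.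
have mF : measurable_fun setT (fun w => l2norm (A *m X w)).
  (* Integrability of F(X)^2 already contains its measurability, and F is the
     square root of F^2. *)
  have -> : (fun w => l2norm (A *m X w)) =
      Num.sqrt \o (fun w => l2norm (A *m X w) ^+ 2).
    by apply/funext => w; rewrite /= sqrtr_sqr ger0_norm ?l2norm_ge0.
  apply: (measurableT_comp (continuous_measurable_fun (@sqrt_continuous R))).
  by apply/measurable_EFinP; exact: measurable_int intF.
have [m med_m tail] := concX _ (convex_l2norm_mul A)
  (lipschitz1_l2norm_mul (nonexpansive_weighted_coord orthu c01)).
apply: (tail_recenter hC0 hC0' K_gt0 mF _ tail) => //.
apply: (sqr_rms_sub_le s_gt0 _ mF intF) => //.
- by apply: median_ge0 med_m => w; exact: l2norm_ge0.
- by rewrite EF trace_weighted_coord// sqr_sqrtr.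
have -> : C0 / C0' * K ^+ 2 = C0 / (C0' / K ^+ 2) by field; rewrite !lt0r_neq0.
apply: integral_sqr_le_of_tail => //.
- exact: ltW.
- by rewrite divr_gt0// exprn_gt0.
- exact: measurable_funB.
move=> r r_gt0; apply: le_trans (tail r r_gt0) _; rewrite lee_fin.
by rewrite mulrA mulrAC mulNr.
Qed.
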